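(* Let $f=\frac1n\sum_{i=1}^n f_i$ with $f_i:\mathbb{R}^d\to\mathbb{R}$ twice differentiable, and suppose every gradient $\nabla f_i$ is Lipschitz continuous with constant $L_1$. Let $\delta\in(0,1)$ and $\epsilon_{\mathbf B}>0$. For each $t\ge 0$ let $\mathbf{B}_t=\frac{1}{|\mathcal{S}_{\mathbf B,t}|}\sum_{i\in\mathcal{S}_{\mathbf B,t}}\nabla^2 f_i(\mathbf{x}_t)$ be the subsampled Hessian at the iterate $\mathbf{x}_t\in\mathbb{R}^d$, and let $\mathbf{H}(\mathbf{x}_t)=\nabla^2 f(\mathbf{x}_t)$. If $$|\mathcal{S}_{\mathbf B,t}|\ \ge\ \frac{16L_1^2\log\frac{2d}{\delta}}{\epsilon_{\mathbf B}^2},$$ then, for all $t\ge 0$, with probability at least $1-\delta$, $$\|\mathbf{B}_t-\mathbf{H}(\mathbf{x}_t)\|\le \epsilon_{\mathbf B}.$$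
   Context: $\|\cdot\|$ is the spectral (operator $\ell_2$) norm for matrices. The index (multi)set $\mathcal{S}_{\mathbf B,t}$ is formed of data indices drawn independently and uniformly from $\{1,\dots,n\}$ at iteration $t$, independently of $\mathbf{x}_t$, so that $\mathbf{B}_t$ is an unbiased estimator of $\mathbf{H}(\mathbf{x}_t)$; $|\mathcal{S}_{\mathbf B,t}|$ is the number of draws. The probability is over this sampling, and the guarantee is understood for each iteration $t$. *)

(* Defs.v *)
From HB Require Import structures.
From mathcomp Require Import all_boot all_order all_algebra.
From mathcomp Require Import all_classical all_reals all_analysis.

Set Implicit Arguments.
Unset Strict Implicit.
Unset Printing Implicit Defensive.

Import Order.TTheory GRing.Theory Num.Theory.
Import numFieldNormedType.Exports.

Local Open Scope classical_set_scope.
Local Open Scope ring_scope.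

(* Points of R^d are row vectors. The library norm of ['rV[R]_d] is the sup
   norm, which induces the usual topology and the usual differentiability, but
   the Lipschitz condition and the matrix norm refer to the Euclidean norm. *)
Definition l2norm (R : realType) (d : nat) (v : 'rV[R]_d) : R :=
  Num.sqrt (\sum_(j < d) v 0 j ^+ 2).

(* [x *m A^T] is the row vector of the entries of A x. *)
Definition spectral_norm (R : realType) (p q : nat) (A : 'M[R]_(p, q)) : R :=
  sup [set l2norm (x *m A^T) | x in [set x : 'rV[R]_q | l2norm x <= 1]].

Definition gradient (R : realType) (d : nat) (f : 'rV[R]_d -> R)
    (x : 'rV[R]_d) : 'rV[R]_d :=
  \row_(j < d) 'D_(delta_mx 0 j) f x.

Definition twice_differentiable (R : realType) (d : nat)
    (f : 'rV[R]_d -> R) : Prop :=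
  (forall x, differentiable f x) /\ (forall x, differentiable (gradient f) x).

(* The (i, j) entry is the i-th partial derivative of the j-th one. *)
Definition hessian (R : realType) (d : nat) (f : 'rV[R]_d -> R)
    (x : 'rV[R]_d) : 'M[R]_d :=
  jacobian (gradient f) x.

Definition lipschitz_gradient (R : realType) (d : nat) (L : R)
    (f : 'rV[R]_d -> R) : Prop :=
  forall x y, l2norm (gradient f x - gradient f y) <= L * l2norm (x - y).

Definition finite_sum_objective (R : realType) (d n : nat)
    (f : 'I_n -> 'rV[R]_d -> R) (x : 'rV[R]_d) : R :=
  n%:R^-1 * \sum_(i < n) f i x.

(* The sample is the family [s] of the [m] drawn indices, so that repeated
   draws are counted with their multiplicity. *)
Definition subsampled_hessian (R : realType) (d n m : nat)
    (f : 'I_n -> 'rV[R]_d -> R) (s : 'I_m -> 'I_n) (x : 'rV[R]_d) : 'M[R]_d :=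
  m%:R^-1 *: \sum_(j < m) hessian (f (s j)) x.

Definition borel_rV (R : realType) (d : nat) : set (set 'rV[R]_d) :=
  <<s [set A : set 'rV[R]_d | open A] >>.

(* [generated_by X G] is the class of events {X \in A} with A in G. *)
Definition generated_by (T U : Type) (X : T -> U) (G : set (set U)) :
    set (set T) :=
  preimage_set_system setT X G.

Definition independent_classes (dT : measure_display) (T : measurableType dT)
    (R : realType) (P : probability T R) (F G : set (set T)) : Prop :=
  forall A B, F A -> G B -> P (A `&` B) = (P A * P B)%E.

Definition mutually_independent (dT : measure_display) (T : measurableType dT)
    (R : realType) (P : probability T R) (I : finType)
    (F : I -> set (set T)) : Prop :=
  forall (J : {set I}) (E : I -> set T), (forall i, i \in J -> F i (E i)) ->
  P (\bigcap_(i in [set` J]) E i) = (\prod_(i in J) P (E i))%E.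

Record uniform_sampling (dT : measure_display) (T : measurableType dT)
    (R : realType) (P : probability T R) (d n m : nat)
    (x : T -> 'rV[R]_d) (xi : 'I_m -> T -> 'I_n) : Prop := UniformSampling {
  point_measurable : generated_by x (@borel_rV R d) `<=` measurable ;
  draw_measurable : forall j, generated_by (xi j) setT `<=` measurable ;
  draw_uniform : forall j i, P (xi j @^-1` [set i]) = (n%:R^-1)%:E ;
  draws_independent :
    mutually_independent P (fun j => generated_by (xi j) setT) ;
  draws_independent_of_point :
    independent_classes P
      (generated_by (fun w => [ffun j => xi j w]) setT)
      (generated_by x (@borel_rV R d)) }.

(* Main.v *)
Require Import Defs.
From HB Require Import structures.
From mathcomp Require Import all_boot all_order all_algebra.
From mathcomp Require Import all_classical all_reals all_analysis.
From mathcomp Require Import measurable_realfun ring lra zify.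
Import Order.TTheory GRing.Theory Num.Theory.
Import numFieldNormedType.Exports.
Local Open Scope classical_set_scope.
Local Open Scope ring_scope.

Set Implicit Arguments.
Unset Strict Implicit.
Unset Printing Implicit Defensive.

(** For a fixed point the sample is uniform over the [n ^ m] index maps [s], so
    everything reduces to counting the [s] with a large deviation. Passing to
    the Hermitian dilation [Z_i] of [H_i - H], which doubles the dimension,
    makes the summands symmetric without appealing to the symmetry of second
    derivatives. With [S = \sum_j Z_(s j)] and [S'] the sum after resampling
    coordinate [j], exchangeability gives
    [E tr (Z_(s j) S^(2r+1)) = 1/2 E tr ((S - S') (S^(2r+1) - S'^(2r+1)))], and a
    convexity inequality for [k |-> tr (D S^k D S'^(2r-k))], proved by writing
    its second differences as squared Frobenius norms, bounds this by
    [(2r+1) L^2 E (tr (S^2r) + tr (S'^2r))]. Hence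
    [E tr (S^2p) <= 2d (2p-1)!! (2 m L^2)^p <= 2d (2 m L^2 p)^p], and Markov's
    inequality with [u <= p <= 2u], [u = m eps^2 / (16 L^2)], yields the tail
    [2d 4^(-p) <= 2d e^(-u)]. No matrix exponential is involved. Independence of
    the sample and the iterate transfers the count to the probability. *)

(** * Squared Euclidean norms, traces and discrete convexity, without square roots *)

Definition sqnorm (R : realFieldType) (d : nat) (v : 'rV[R]_d) : R := \sum_(j < d) v 0 j ^+ 2.

Section Sq.
Variable R : realFieldType.

Lemma sqnorm_ge0 d (v : 'rV[R]_d) : 0 <= sqnorm v.
Proof. by apply: sumr_ge0 => j _; exact: sqr_ge0. Qed.

Lemma sqnormE d (v : 'rV[R]_d) : sqnorm v = (v *m v^T) 0 0.
Proof. by rewrite mxE; apply: eq_bigr => j _; rewrite mxE expr2. Qed.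

Lemma sqnorm0 d : sqnorm (0 : 'rV[R]_d) = 0.
Proof. by apply: big1 => j _; rewrite mxE expr0n. Qed.

Lemma sqnormZ d a (v : 'rV[R]_d) : sqnorm (a *: v) = a ^+ 2 * sqnorm v.
Proof. by rewrite /sqnorm mulr_sumr; apply: eq_bigr => j _; rewrite mxE exprMn. Qed.

Lemma sqnorm_row_mx d e (v : 'rV[R]_d) (w : 'rV[R]_e) :
  sqnorm (row_mx v w) = sqnorm v + sqnorm w.
Proof.
rewrite /sqnorm big_split_ord /=; congr (_ + _); apply: eq_bigr => j _.
  by rewrite row_mxEl.
by rewrite row_mxEr.
Qed.

Lemma sqnorm_eq0 d (v : 'rV[R]_d) : (sqnorm v == 0) = (v == 0).
Proof.
apply/eqP/eqP => [h|->]; last exact: sqnorm0.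
apply/rowP => j; rewrite mxE; apply/eqP; rewrite -sqrf_eq0 eq_le sqr_ge0 andbT -h.
rewrite /sqnorm (bigD1 j) //= lerDl; apply: sumr_ge0 => *; exact: sqr_ge0.
Qed.

Lemma sqnormB_scale d a b (v w : 'rV[R]_d) :
  sqnorm (a *: v - b *: w) =
  a ^+ 2 * sqnorm v - 2 * a * b * (v *m w^T) 0 0 + b ^+ 2 * sqnorm w.
Proof.
rewrite /sqnorm mxE !mulr_sumr -sumrB -big_split; apply: eq_bigr => j _ /=.
by rewrite !mxE; ring.
Qed.

Lemma row_cauchy_schwarz d (v w : 'rV[R]_d) :
  (v *m w^T) 0 0 ^+ 2 <= sqnorm v * sqnorm w.
Proof.
have [->|w0] := eqVneq w 0; first by rewrite trmx0 mulmx0 mxE sqnorm0 mulr0 expr0n.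
have wp : 0 < sqnorm w by rewrite lt0r sqnorm_eq0 w0 sqnorm_ge0.
(* Expanding this square gives [sqnorm w] times the Cauchy-Schwarz gap. *)
have := sqnorm_ge0 (sqnorm w *: v - (v *m w^T) 0 0 *: w).
rewrite sqnormB_scale => h; rewrite -(ler_pM2l wp); nra.
Qed.

(** With [u = w *m A^T], the squared norm of [u] is the inner product of [u *m A] and [w].
    Cauchy-Schwarz and the bound on [A] then leave one factor [sqnorm u] to cancel. *)
Lemma sqnorm_mulmx_tr d e c (A : 'M[R]_(d, e)) : 0 <= c ->
  (forall v, sqnorm (v *m A) <= c * sqnorm v) ->
  forall w, sqnorm (w *m A^T) <= c * sqnorm w.
Proof.
move=> c0 hA w; set u := w *m A^T.
have [u0|u0] := eqVneq (sqnorm u) 0; first by rewrite u0 mulr_ge0 ?sqnorm_ge0.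
have up : 0 < sqnorm u by rewrite lt0r u0 sqnorm_ge0.
have h : sqnorm u = (u *m A *m w^T) 0 0.
  by rewrite sqnormE {2}/u trmx_mul trmxK mulmxA.
have := row_cauchy_schwarz (u *m A) w; rewrite -h => h1.
have h2 := hA u; have w0 := sqnorm_ge0 w.
rewrite -(ler_pM2l up) -expr2 (le_trans h1) // mulrA [sqnorm u * c]mulrC.
exact: ler_wpM2r.
Qed.

Lemma mxtrace_mulmx_tr m n (X : 'M[R]_(m, n)) :
  \tr (X *m X^T) = \sum_i sqnorm (row i X).
Proof.
apply: eq_bigr => i _; rewrite mxE; apply: eq_bigr => j _.
by rewrite !mxE expr2.
Qed.

Lemma mxtrace_mulmx_tr_ge0 m n (X : 'M[R]_(m, n)) : 0 <= \tr (X *m X^T).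
Proof. by rewrite mxtrace_mulmx_tr sumr_ge0 // => i _; exact: sqnorm_ge0. Qed.

Lemma mxtrace_mulmxr_le m n p c (X : 'M[R]_(m, n)) (Y : 'M[R]_(n, p)) :
  (forall v, sqnorm (v *m Y) <= c * sqnorm v) ->
  \tr ((X *m Y) *m (X *m Y)^T) <= c * \tr (X *m X^T).
Proof.
move=> hY; rewrite !mxtrace_mulmx_tr mulr_sumr; apply: ler_sum => i _.
by rewrite row_mul.
Qed.

(** Cauchy-Schwarz against each column of [X]: the Frobenius norm dominates the operator norm. *)
Lemma sqnorm_mulmx_le m n (v : 'rV[R]_m) (X : 'M[R]_(m, n)) :
  sqnorm (v *m X) <= sqnorm v * \tr (X *m X^T).
Proof.
rewrite mxtrace_mulC {1}/sqnorm -{3}[X]trmxK mxtrace_mulmx_tr mulr_sumr.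
apply: ler_sum => j _; suff -> : (v *m X) 0 j = (v *m (row j X^T)^T) 0 0.
  exact: row_cauchy_schwarz.
by rewrite !mxE; apply: eq_bigr => k _; rewrite !mxE.
Qed.

Lemma trmxX n (S : 'M[R]_n) k : S^T = S -> (S ^+ k)^T = S ^+ k.
Proof.
move=> hS; elim: k => [|k IH]; first by rewrite !expr0 trmx1.
by rewrite [in LHS]exprS trmx_mul IH hS; exact: esym (exprSr _ _).
Qed.

Lemma mxtrace_mulrC n (A B : 'M[R]_n) : \tr (A * B) = \tr (B * A).
Proof. exact: mxtrace_mulC. Qed.

Lemma mulmxX_inner n (S : 'M[R]_n) (v : 'rV[R]_n) i j : S^T = S ->
  (v *m S ^+ i) *m (v *m S ^+ j)^T = v *m S ^+ (i + j) *m v^T.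
Proof. by move=> hS; rewrite trmx_mul trmxX // mulmxA -(mulmxA v) mulmxE -exprD. Qed.

(* Consecutive squared norms of [v S^k] form a log-convex sequence. *)
Lemma sqnorm_mulmxX_ge n (S : 'M[R]_n) (v : 'rV[R]_n) k : S^T = S ->
  sqnorm v <= 1 -> sqnorm (v *m S) ^+ k.+1 <= sqnorm (v *m S ^+ k.+1).
Proof.
move=> hS hv; set t := sqnorm (v *m S); pose a i := sqnorm (v *m S ^+ i).
have logconvex i : a i.+1 ^+ 2 <= a i * a i.+2.
  suff -> : a i.+1 = ((v *m S ^+ i) *m (v *m S ^+ i.+2)^T) 0 0.
    exact: row_cauchy_schwarz.
  by rewrite /a sqnormE !mulmxX_inner // addSnnS.
have [t0|t0] := eqVneq t 0; first by rewrite t0 expr0n sqnorm_ge0.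
have tp : 0 < t by rewrite lt0r t0 sqnorm_ge0.
have a0 : a 0%N = sqnorm v by rewrite /a expr0 mulmx1.
have a1 : a 1%N = t by rewrite /a expr1.
(* By log-convexity the ratios [a i.+1 / a i] do not decrease, and the first one is at least [t]
   because [a 0 <= 1]. Positivity is carried along to allow the cancellation. *)
have growth i : 0 < a i /\ t * a i <= a i.+1.
  elim: i => [|i [ai IH]].
    rewrite a0 a1 ger_pMr //; split=> //; rewrite lt0r sqnorm_ge0 andbT sqnorm_eq0.
    by apply: contra_neq t0 => v0; rewrite /t v0 mul0mx sqnorm0.
  have ai1 : 0 < a i.+1 by rewrite (lt_le_trans _ IH) // mulr_gt0.
  split=> //; rewrite -(ler_pM2l ai); apply: le_trans (logconvex i).
  by rewrite expr2 mulrCA mulrA; apply: ler_wpM2r => //; exact: ltW.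
rewrite -/(a _); elim: k => [|k IH]; first by rewrite a1 expr1.
by rewrite exprS (le_trans _ (growth _).2) // ler_pM2l.
Qed.

(** A discrete trapezoid bound. Increments of [g] do not decrease, so [g j + g (r - j)] is largest
    at the ends; adding the sum to its reversal gives the claim. *)
Lemma convex_sum_le (g : nat -> R) r :
  (forall j, (j.+2 <= r)%N -> 2 * g j.+1 <= g j + g j.+2) ->
  \sum_(j < r.+1) g j <= (r.+1)%:R / 2 * (g 0%N + g r).
Proof.
move=> hg.
have slope i j : (i <= j)%N -> (j < r)%N -> g i.+1 - g i <= g j.+1 - g j.
  move=> /subnK <-; elim: (j - i)%N => [|k IH] hk; first by rewrite add0n.
  have := IH (ltnW hk); have := hg _ hk; rewrite addSn; lra.
have ends j : (2 * j <= r)%N -> g j + g (r - j)%N <= g 0%N + g r.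
  elim: j => [|j IH] hj; first by rewrite subn0.
  have := IH ltac:(lia); have := slope j (r - j.+1)%N ltac:(lia) ltac:(lia).
  have -> : (r - j.+1).+1 = (r - j)%N by lia.
  lra.
have endsT j : (j <= r)%N -> g j + g (r - j)%N <= g 0%N + g r.
  move=> hj; have [h|h] := leqP (2 * j) r; first exact: ends.
  by have := ends (r - j)%N ltac:(lia); rewrite subKn // addrC.
have flip : \sum_(j < r.+1) g j = \sum_(j < r.+1) g (r - j)%N.
  rewrite (reindex_inj rev_ord_inj) /=; apply: eq_bigr => j _.
  by rewrite subSS.
suff : \sum_(j < r.+1) g j + \sum_(j < r.+1) g j <= r.+1%:R * (g 0%N + g r) by lra.
rewrite {2}flip -big_split /=.
apply: le_trans (ler_sum _ (fun (j : 'I_r.+1) _ => endsT j (ltn_ord j))) _.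
by rewrite sumr_const card_ord mulr_natl.
Qed.

(** * Mixed traces of powers of two symmetric matrices *)

Section TraceInequality.
Variables (n : nat) (D S S' : 'M[R]_n).
Hypotheses (hD : D^T = D) (hS : S^T = S) (hS' : S'^T = S').

Let h k l := \tr (D * S ^+ k * D * S' ^+ l).

Let X a b := S ^+ a * D * S' ^+ b.

Let X_inner a b a' b' : \tr (X a b *m (X a' b')^T) = h (a + a') (b + b').
Proof.
rewrite /X -!mulmxE [in LHS]trmx_mul [in LHS]trmx_mul !trmxX // hD !mulmxE.
transitivity (\tr (S ^+ a * (D * S' ^+ (b + b') * D * S ^+ a'))).
  by rewrite exprD !mulrA.
rewrite mxtrace_mulrC -(mulrA _ _ (S ^+ a)) -exprD (addnC a').
transitivity (\tr ((D * S' ^+ (b + b')) * (D * S ^+ (a + a')))).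
  by rewrite !mulrA.
by rewrite mxtrace_mulrC !mulrA.
Qed.

(** By [X_inner] the values of [h] are Frobenius inner products, and this is the nonnegativity of
    the squared norm of [X a b - X a' b']. *)
Let h_mid_le a b a' b' : 2 * h (a + a') (b + b') <= h (a + a) (b + b) + h (a' + a') (b' + b').
Proof.
have := mxtrace_mulmx_tr_ge0 (X a b - X a' b').
rewrite linearB /= mulmxBl !mulmxBr !raddfB /= !X_inner (addnC a') (addnC b'); lra.
Qed.

(* With even total degree the sequence [k |-> tr (D S^k D S'^(2r-k))] is
   dominated at odd [k] by its neighbours and convex along even [k]. *)
Lemma mxtrace_convex_sum_le r :
  \sum_(k < (2 * r).+1) \tr (D * S ^+ k * D * S' ^+ (2 * r - k)) <=
  (2 * r).+1%:R / 2 * (\tr (D * D * S ^+ (2 * r)) + \tr (D * D * S' ^+ (2 * r))).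
Proof.
pose f k := h k (2 * r - k); pose g j := f (2 * j)%N.
have f0 : f 0%N = \tr (D * D * S' ^+ (2 * r)) by rewrite /f /h expr0 mulr1 subn0.
have fr : f (2 * r)%N = \tr (D * D * S ^+ (2 * r)).
  by rewrite /f /h subnn expr0 mulr1 mxtrace_mulrC mulrA.
rewrite -f0 -fr -/h.
have gE j : (j <= r)%N -> g j = h (j + j) ((r - j) + (r - j)).
  by move=> hj; rewrite /g /f; congr (h _ _); lia.
(* Here [2j+1 = j + (j+1)] is the midpoint of [2j] and [2(j+1)]; below, [2(j+1) = j + (j+2)] plays
   the same part for [g]. *)
have fodd j : (j < r)%N -> 2 * f (2 * j).+1 <= g j + g j.+1.
  move=> hj; rewrite !gE //; last exact: ltnW.
  have -> : f (2 * j).+1 = h (j + j.+1) ((r - j) + (r - j.+1)).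
    by rewrite /f; congr (h _ _); lia.
  exact: h_mid_le.
have gconv j : (j.+2 <= r)%N -> 2 * g j.+1 <= g j + g j.+2.
  move=> hj; rewrite (gE j) ?(gE j.+2) //; last by lia.
  have -> : g j.+1 = h (j + j.+2) ((r - j) + (r - j.+2)).
    by rewrite /g /f; congr (h _ _); lia.
  exact: h_mid_le.
have split_sum q : 2 * (\sum_(k < (2 * q).+1) f k) =
    2 * \sum_(j < q.+1) g j + \sum_(j < q) (2 * f (2 * j).+1).
  elim: q => [|q IH]; first by rewrite !big_ord1 big_ord0 addr0.
  have -> : (2 * q.+1).+1 = (2 * q).+3 by lia.
  rewrite 2!big_ord_recr /= !mulrDr IH [in RHS]big_ord_recr [X in _ = _ + X]big_ord_recr /=.
  have -> : f (2 * q).+2 = g q.+1 by rewrite /g; congr f; lia.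
  rewrite mulrDr; ring.
(* Summing [fodd] counts each interior [g j] twice and each end once. *)
have odd_le q : (q <= r)%N -> \sum_(j < q) (2 * f (2 * j).+1) <=
    2 * (\sum_(j < q.+1) g j) - g 0%N - g q.
  elim: q => [|q IH] hq; first by rewrite big_ord0 big_ord1; lra.
  have := IH (ltnW hq); have := fodd q hq.
  rewrite [\sum_(j < q.+1) (2 * _)]big_ord_recr [\sum_(j < q.+2) _]big_ord_recr /=; lra.
(* Twice the sum is at most [4 * \sum g - (g 0 + g r)], hence at most
   [(2(r+1) - 1) * (g 0 + g r)]. *)
have := odd_le r (leqnn r); have := split_sum r; have := convex_sum_le gconv.
rewrite -[\sum_(k < _) \tr _]/(\sum_(k < (2 * r).+1) f k) /g muln0.
have -> : (2 * r).+1%:R = 2 * r.+1%:R - 1 :> R by rewrite -!natr1 natrM; ring.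
lra.
Qed.

End TraceInequality.
End Sq.

(** Since [x] and [y] need not commute, [x - y] stays between the powers; this is the shape of the
    traces in [mxtrace_convex_sum_le]. *)
Lemma subrX_telescope (R : pzRingType) (x y : R) q :
  x ^+ q.+1 - y ^+ q.+1 = \sum_(k < q.+1) x ^+ k * (x - y) * y ^+ (q - k).
Proof.
elim: q => [|q IH]; first by rewrite big_ord1 !expr0 !expr1 mul1r mulr1.
rewrite big_ord_recr /= subnn expr0 mulr1.
have -> : \sum_(k < q.+1) x ^+ k * (x - y) * y ^+ (q.+1 - k) =
    (x ^+ q.+1 - y ^+ q.+1) * y.
  rewrite IH mulr_suml; apply: eq_bigr => k _.
  by rewrite (subSn (ltn_ord k : (k <= q)%N)) [y ^+ _.+1]exprSr mulrA.
by rewrite mulrBl mulrBr -!exprSr addrC addrA subrK.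
Qed.

(** Each factor is paired with its mirror image: the two sum to [2p], so their product is at most
    [p ^ 2], and the square of the product is at most [p ^ (2p)]. *)
Lemma prod_odd_le p : (\prod_(k < p) (2 * k).+1 <= p ^ p)%N.
Proof.
have flip : (\prod_(k < p) (2 * k).+1 = \prod_(k < p) (2 * (p - k.+1)).+1)%N.
  by rewrite (reindex_inj rev_ord_inj).
rewrite -leq_sqr -mulnn {2}flip -big_split -expnM mulnC expnM -[p in leqRHS]card_ord.
rewrite -prod_nat_const; apply: leq_prod => -[k hk] _ /=; rewrite -mulnn.
have [b -> {hk}] : exists b, p = (k + b).+1 by exists (p - k.+1)%N; lia.
rewrite card_ord subSS addKn.
(* With [p = k + b + 1], [p ^ 2] exceeds [(2k+1)(2b+1)] by the square of [k - b]. Ordering [k] and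
   [b] makes this difference a natural number [c]. *)
have [/subnKC <-|/ltnW/subnKC <-] := leqP k b.
  by move: (b - k)%N => c; nia.
by move: (k - b)%N => c; nia.
Qed.

(** * Even trace moments of a sum of uniformly drawn matrices *)

Section Moments.
Variables (R : realFieldType) (N : nat).

(** By cyclicity the left side is the squared Frobenius norm of [S ^+ r * D]. *)
Lemma mxtrace_sqr_mulX_le c (D S : 'M[R]_N) r : D^T = D -> S^T = S ->
  (forall v, sqnorm (v *m D) <= c * sqnorm v) ->
  \tr (D * D * S ^+ (2 * r)) <= c * \tr (S ^+ (2 * r)).
Proof.
move=> hD hS hc; have := mxtrace_mulmxr_le (S ^+ r) hc.
rewrite trmx_mul trmxX // hD !mulmxE -exprD addnn -mul2n.
suff -> : \tr (S ^+ r * D * (D * S ^+ r)) = \tr (D * D * S ^+ (2 * r)) by [].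
rewrite mxtrace_mulrC mul2n -addnn exprD mulrA -(mulrA D) mxtrace_mulrC !mulrA.
by rewrite mxtrace_mulrC !mulrA.
Qed.

Lemma mxtrace_mulBX_le c (S S' : 'M[R]_N) r : S^T = S -> S'^T = S' ->
  (forall v, sqnorm (v *m (S - S')) <= c * sqnorm v) ->
  \tr ((S - S') * (S ^+ (2 * r).+1 - S' ^+ (2 * r).+1)) <=
  (2 * r).+1%:R / 2 * c * (\tr (S ^+ (2 * r)) + \tr (S' ^+ (2 * r))).
Proof.
move=> hS hS' hc; have hD : (S - S')^T = S - S' by rewrite linearB /= hS hS'.
rewrite subrX_telescope mulr_sumr raddf_sum /=.
under eq_bigr => k _ do rewrite !mulrA.
apply: le_trans (mxtrace_convex_sum_le hD hS hS' r) _.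
rewrite -[leRHS]mulrA; apply: ler_wpM2l; first by rewrite divr_ge0 ?ler0n.
by rewrite [leRHS]mulrDr lerD // mxtrace_sqr_mulX_le.
Qed.

Definition resample (I : finType) m (s : {ffun 'I_m -> I}) j i : {ffun 'I_m -> I} :=
  [ffun k => if k == j then i else s k].

(** Exchangeability: sending [(s, i)] to the resampled map together with the discarded value [s j]
    is an involution. *)
Lemma sum_resample_swap (I : finType) m j
    (F : {ffun 'I_m -> I} -> {ffun 'I_m -> I} -> R) :
  \sum_(s : {ffun 'I_m -> I}) \sum_i F s (resample s j i) = \sum_s \sum_i F (resample s j i) s.
Proof.
rewrite !pair_big /=.
pose swap (u : {ffun 'I_m -> I} * I) := (resample u.1 j u.2, u.1 j).
have swapK : involutive swap.
  move=> [s i]; rewrite /swap /=; congr pair; last by rewrite ffunE eqxx.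
  by apply/ffunP => k; rewrite !ffunE; case: eqP => // ->.
rewrite (reindex_inj (inv_inj swapK)) /=; apply: eq_bigr => -[s i] _ /=.
by have /(congr1 fst) /= -> := swapK (s, i).
Qed.

Variables (I : finType) (m : nat) (Z : I -> 'M[R]_N) (c : R).
Hypotheses (Zsym : forall i, (Z i)^T = Z i) (Zsum : \sum_i Z i = 0).
Hypothesis Zc : forall i k v, sqnorm (v *m (Z i - Z k)) <= c * sqnorm v.

Definition sample_sum (s : {ffun 'I_m -> I}) := \sum_j Z (s j).

Lemma sample_sum_sym s : (sample_sum s)^T = sample_sum s.
Proof. by rewrite /sample_sum linear_sum; apply: eq_bigr => j _ /=. Qed.

Lemma sample_sum_resample s j i :
  sample_sum s - sample_sum (resample s j i) = Z (s j) - Z i.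
Proof.
rewrite /sample_sum (bigD1 j) //= [X in _ - X](bigD1 j) //= ffunE eqxx.
rewrite [X in _ - (_ + X)](eq_bigr (fun k => Z (s k))).
  by rewrite opprD addrACA subrr addr0.
by move=> k /negPf kj; rewrite ffunE kj.
Qed.

Lemma moment_coord_le j r :
  \sum_(s : {ffun 'I_m -> I}) \tr (Z (s j) * sample_sum s ^+ (2 * r).+1) <=
  (2 * r).+1%:R / 2 * c * \sum_(s : {ffun 'I_m -> I}) \tr (sample_sum s ^+ (2 * r)).
Proof.
have [I0|] := posnP #|I|.
  by rewrite !big1 ?mulr0 // => s _; have := fintype0 (s j) I0.
rewrite -(ltr0n R) => I0; rewrite -(ler_pM2l I0).
pose T s := \tr (sample_sum s ^+ (2 * r)).
pose G s s' := \tr ((sample_sum s - sample_sum s') * sample_sum s ^+ (2 * r).+1).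
(* Summing over the replacement [i] kills the [Z i] term by [Zsum], so [Z (s j)] may be read as the
   change of the sum under resampling. *)
have QE : #|I|%:R * (\sum_(s : {ffun 'I_m -> I}) \tr (Z (s j) * sample_sum s ^+ (2 * r).+1)) =
    \sum_(s : {ffun 'I_m -> I}) \sum_i G s (resample s j i).
  rewrite mulr_sumr; apply: eq_bigr => s _; rewrite /G.
  under eq_bigr do rewrite sample_sum_resample mulrBl raddfB /=.
  rewrite sumrB -[X in _ = _ - X]raddf_sum /= -mulr_suml Zsum mul0r mxtrace0 subr0.
  by rewrite sumr_const mulr_natl.
have TE : \sum_(s : {ffun 'I_m -> I}) \sum_i T (resample s j i) = #|I|%:R * \sum_s T s.
  rewrite -(sum_resample_swap j (fun s _ => T s)) mulr_sumr.
  by apply: eq_bigr => s _; rewrite sumr_const mulr_natl.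
have TE' : \sum_(s : {ffun 'I_m -> I}) \sum_(i : I) T s = #|I|%:R * \sum_s T s.
  by rewrite mulr_sumr; apply: eq_bigr => s _; rewrite sumr_const mulr_natl.
(* Of two equal copies, one is kept and the other swapped; together they form
   [(S - S') * (S ^+ q - S' ^+ q)] with [q = 2r+1]. *)
suff : #|I|%:R * (\sum_(s : {ffun 'I_m -> I}) \tr (Z (s j) * sample_sum s ^+ (2 * r).+1)) +
       #|I|%:R * (\sum_(s : {ffun 'I_m -> I}) \tr (Z (s j) * sample_sum s ^+ (2 * r).+1)) <=
    (2 * r).+1%:R / 2 * c * (#|I|%:R * (\sum_(s : {ffun 'I_m -> I}) T s) + #|I|%:R * (\sum_s T s)).
  rewrite /T; lra.
rewrite {2}QE (sum_resample_swap j G) QE -{1}TE' -TE -!big_split /= mulr_sumr.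
apply: ler_sum => s _; rewrite -!big_split mulr_sumr; apply: ler_sum => i _ /=.
have hc v : sqnorm (v *m (sample_sum s - sample_sum (resample s j i))) <= c * sqnorm v.
  by rewrite sample_sum_resample.
apply: le_trans (mxtrace_mulBX_le r (sample_sum_sym _) (sample_sum_sym _) hc).
rewrite /G -(opprB (sample_sum s)) mulNr raddfN /= -raddfB /= -mulrBr.
by [].
Qed.

Lemma moment_step r :
  \sum_(s : {ffun 'I_m -> I}) \tr (sample_sum s ^+ (2 * r.+1)) <=
  m%:R * ((2 * r).+1%:R / 2 * c) * \sum_(s : {ffun 'I_m -> I}) \tr (sample_sum s ^+ (2 * r)).
Proof.
have -> : \sum_(s : {ffun 'I_m -> I}) \tr (sample_sum s ^+ (2 * r.+1)) =
    \sum_(j < m) \sum_(s : {ffun 'I_m -> I}) \tr (Z (s j) * sample_sum s ^+ (2 * r).+1).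
  rewrite [RHS]exchange_big /=; apply: eq_bigr => s _.
  rewrite -raddf_sum /= -mulr_suml -exprS; congr (\tr (_ ^+ _)); lia.
apply: le_trans (ler_sum _ (fun j _ => moment_coord_le j r)) _.
by rewrite sumr_const card_ord -[leLHS]mulr_natl !mulrA.
Qed.

(** Iterating [moment_step] from the zeroth power, whose trace is [N] for each of the [#|I| ^ m]
    maps, produces the product of odd numbers, coarsened at the end to [p ^ p]. *)
Lemma moment_le p : 0 <= c ->
  \sum_(s : {ffun 'I_m -> I}) \tr (sample_sum s ^+ (2 * p)) <=
  (m%:R * c / 2 * p%:R) ^+ p * (N%:R * #|I|%:R ^+ m).
Proof.
move=> c0; have h0 : 0 <= m%:R * c / 2 by rewrite divr_ge0 ?mulr_ge0 ?ler0n.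
suff : \sum_(s : {ffun 'I_m -> I}) \tr (sample_sum s ^+ (2 * p)) <=
  (m%:R * c / 2) ^+ p * (\prod_(k < p) (2 * k).+1)%:R * (N%:R * #|I|%:R ^+ m).
  move=> /le_trans; apply; apply: ler_wpM2r; first by rewrite mulr_ge0 ?exprn_ge0 ?ler0n.
  by rewrite [leRHS]exprMn ler_wpM2l ?exprn_ge0 // -natrX ler_nat prod_odd_le.
elim: p => [|p IH].
  rewrite big_ord0 expr0 !mul1r.
  under eq_bigr => s _ do rewrite muln0 expr0 mxtrace1.
  by rewrite sumr_const card_ffun card_ord -[leLHS]mulr_natr natrX.
apply: le_trans (moment_step _) _; rewrite big_ord_recr exprS natrM /=.
have k0 : 0 <= m%:R * ((2 * p).+1%:R / 2 * c).
  by rewrite !mulr_ge0 ?invr_ge0 ?ler0n.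
apply: le_trans (ler_wpM2l k0 IH) _; rewrite le_eqVlt; apply/orP; left; apply/eqP.
ring.
Qed.
End Moments.

(** * The Hermitian dilation of a square matrix *)

Section Dilation.
Variables (R : realFieldType) (d : nat).
Implicit Type A : 'M[R]_d.

Definition dilation A : 'M[R]_(d + d) := block_mx 0 A A^T 0.

Lemma dilation_sym A : (dilation A)^T = dilation A.
Proof. by rewrite /dilation tr_block_mx !trmx0 trmxK. Qed.

Lemma dilationB A B : dilation (A - B) = dilation A - dilation B.
Proof. by rewrite /dilation opp_block_mx add_block_mx !subr0 linearB. Qed.

Lemma dilation_sum (I : finType) (A : I -> 'M[R]_d) :
  dilation (\sum_i A i) = \sum_i dilation (A i).
Proof.
elim/big_ind2: _ => [|X x Y y <- <-|//].
  by rewrite /dilation trmx0 -block_mx0.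
by rewrite /dilation add_block_mx !addr0 linearD.
Qed.

Lemma mul_row_mx_dilation A (v w : 'rV[R]_d) :
  row_mx v w *m dilation A = row_mx (w *m A^T) (v *m A).
Proof. by rewrite /dilation mul_row_block !mulmx0 addr0 add0r. Qed.

(** The two halves of the vector are exchanged, one acted on by [A] and the other by its transpose,
    which obeys the same bound. *)
Lemma sqnorm_dilation_le c A : 0 <= c ->
  (forall v, sqnorm (v *m A) <= c * sqnorm v) ->
  forall v, sqnorm (v *m dilation A) <= c * sqnorm v.
Proof.
move=> c0 hA v; rewrite -[v]hsubmxK mul_row_mx_dilation !sqnorm_row_mx.
by rewrite addrC mulrDr lerD // sqnorm_mulmx_tr.
Qed.

End Dilation.

(** * Elementary estimates for the tail bound *)

Lemma sqnormB_le (R : realFieldType) d (v w : 'rV[R]_d) :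
  sqnorm (v - w) <= 2 * (sqnorm v + sqnorm w).
Proof.
rewrite /sqnorm -big_split mulr_sumr; apply: ler_sum => j _ /=; rewrite !mxE.
have := sqr_ge0 (v 0 j + w 0 j); lra.
Qed.

Lemma expR_half_le2 (R : realType) : expR 2^-1 <= 2 :> R.
Proof.
have := expR_ge1Dx (- 2^-1 : R); rewrite expRN => h.
have : 2^-1 <= (expR 2^-1)^-1 :> R by lra.
by rewrite lef_pV2 ?posrE // expR_gt0.
Qed.

Lemma expR1_le4 (R : realType) : expR 1 <= 4 :> R.
Proof.
have -> : 1 = 2^-1 + 2^-1 :> R by lra.
have := expR_gt0 (2^-1 : R); have := expR_half_le2 R; rewrite expRD; nra.
Qed.

(** Supplies an integer moment order [p]: it is [1] for [u <= 1], and otherwise at most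
    [u + 1 <= 2 * u]. *)
Lemma exists_nat_between_double (R : realType) (u : R) : 2^-1 <= u ->
  exists p : nat, [/\ (0 < p)%N, u <= p%:R & p%:R <= 2 * u].
Proof.
move=> hu; have [u1|u1] := leP u 1; first by exists 1%N; split=> //; lra.
exists (Num.truncn u).+1; have /andP[h1 h2] := truncn_itv (ltW (lt_trans ltr01 u1)).
split=> //; first exact: ltW.
rewrite -natr1; lra.
Qed.

(** * Counting the samples with a large deviation *)

Section Count.
Variables (R : realType) (d n m : nat) (A : 'I_n -> 'M[R]_d).

Definition sample_deviation (s : {ffun 'I_m -> 'I_n}) : 'M[R]_d :=
  m%:R^-1 *: (\sum_j A (s j)) - n%:R^-1 *: \sum_i A i.

Lemma sample_deviationE (s : {ffun 'I_m -> 'I_n}) (g : 'I_m -> 'I_n) : s =1 g ->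
  sample_deviation s = m%:R^-1 *: (\sum_j A (g j)) - n%:R^-1 *: \sum_i A i.
Proof.
by move=> sg; rewrite /sample_deviation; under eq_bigr do rewrite sg.
Qed.

Lemma deviation_count (L eps delta : R) (P : pred {ffun 'I_m -> 'I_n}) :
  0 < L -> 0 < eps -> 0 < delta -> delta < 1 -> (0 < d)%N ->
  (forall i v, sqnorm (v *m A i) <= L ^+ 2 * sqnorm v) ->
  16 * L ^+ 2 * ln (2 * d%:R / delta) / eps ^+ 2 <= m%:R ->
  (forall s, P s -> exists2 v, sqnorm v <= 1 &
     eps ^+ 2 <= sqnorm (v *m (sample_deviation s)^T)) ->
  #|P|%:R <= delta * n%:R ^+ m.
Proof.
move=> L0 e0 delta0 delta1 d0 hA hm hP.
have L2 : 0 < L ^+ 2 by rewrite exprn_gt0.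
have e2 : 0 < eps ^+ 2 by rewrite exprn_gt0.
have d1 : 1 <= d%:R :> R by rewrite ler1n.
(* The exponent of the tail: the sample size condition says exactly [ln (2d / delta) <= u]. *)
pose u := m%:R * eps ^+ 2 / (16 * L ^+ 2).
have lnu : ln (2 * d%:R / delta) <= u.
  by rewrite /u ler_pdivlMr ?mulr_gt0 // mulrC -ler_pdivrMr.
have q0 : 2 <= 2 * d%:R / delta by rewrite ler_pdivlMr //; nra.
have dexp : 2 * d%:R <= delta * expR u.
  rewrite [leRHS]mulrC -ler_pdivrMr //.
  by rewrite -[X in X <= _]lnK ?ler_expR // posrE (lt_le_trans _ q0).
(* Because [expR u >= 2d / delta >= 2], which is at least [expR 2^-1]. *)
have u_half : 2^-1 <= u.
  have : expR 2^-1 <= expR u.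
    apply: (le_trans (expR_half_le2 R)); have := expR_gt0 u; nra.
  by rewrite ler_expR.
have [p [p0 up pu]] := exists_nat_between_double u_half.
have m0 : 0 < m%:R :> R.
  rewrite ltNge; apply/negP => m0; move: u_half; rewrite /u.
  have -> : m%:R = 0 :> R by apply/eqP; rewrite eq_le m0 ler0n.
  by rewrite !mul0r; lra.
case: (posnP n) => [n0|n0].
  suff -> : #|P| = 0%N by rewrite mulr_ge0 ?exprn_ge0 // ltW.
  apply: eq_card0 => s; have m0' : (0 < m)%N by rewrite -(ltr0n R).
  by case: (s (Ordinal m0')) => i; rewrite [X in (_ < X)%N]n0.
have n0' : n%:R != 0 :> R by rewrite pnatr_eq0 -lt0n.
pose Abar := n%:R^-1 *: \sum_i A i.
pose Z i := dilation (A i - Abar).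
have Zsym i : (Z i)^T = Z i by exact: dilation_sym.
have Zsum : \sum_i Z i = 0.
  rewrite -dilation_sum sumrB sumr_const card_ord -scaler_nat /Abar scalerA.
  by rewrite divff // scale1r subrr /dilation trmx0 block_mx0.
(* The mean cancels in the difference, and the squared norm of a difference is at most twice the sum
   of two terms bounded by [L ^+ 2]: hence the factor 4. *)
have Zc i k v : sqnorm (v *m (Z i - Z k)) <= 4 * L ^+ 2 * sqnorm v.
  rewrite -dilationB opprB addrA subrK; apply: sqnorm_dilation_le => [|w].
    by rewrite mulr_ge0 // ltW.
  rewrite mulmxBr (le_trans (sqnormB_le _ _)) //.
  have := hA i w; have := hA k w; lra.
have SE s : sample_sum Z s = dilation (m%:R *: sample_deviation s).
  rewrite /sample_sum -dilation_sum; congr dilation.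
  rewrite sumrB sumr_const card_ord scalerBr scalerA divff ?gt_eqF // scale1r.
  by rewrite -scaler_nat.
(* The squared threshold for the unnormalised sum, which is [m] times the deviation. *)
pose T : R := m%:R ^+ 2 * eps ^+ 2.
have T0 : 0 < T by rewrite mulr_gt0 // exprn_gt0.
have tr_ge s : 0 <= \tr (sample_sum Z s ^+ (2 * p)).
  rewrite mul2n -addnn exprD -{2}(trmxX p (sample_sum_sym Zsym s)).
  exact: mxtrace_mulmx_tr_ge0.
have markov s : P s -> T ^+ p <= \tr (sample_sum Z s ^+ (2 * p)).
  move=> /hP[v v1 hv]; rewrite mul2n -addnn exprD.
  rewrite -{2}(trmxX p (sample_sum_sym Zsym s)).
  (* The dilation sends this vector to [v] times the transposed deviation, scaled by [m].
     Log-convexity lifts the bound to the [p]-th power, and the Frobenius norm dominates it. *)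
  pose w := row_mx (0 : 'rV[R]_d) v.
  have w1 : sqnorm w <= 1 by rewrite sqnorm_row_mx sqnorm0 add0r.
  apply: (@le_trans _ _ (sqnorm (w *m sample_sum Z s ^+ p))); last first.
    apply: le_trans (sqnorm_mulmx_le _ _) _.
    by rewrite -[leRHS]mul1r ler_wpM2r // mxtrace_mulmx_tr_ge0.
  rewrite -(prednK p0).
  apply: le_trans (sqnorm_mulmxX_ge _ (sample_sum_sym Zsym s) w1).
  apply: lerXn2r; rewrite ?nnegrE ?sqnorm_ge0 //; first exact: ltW.
  rewrite SE mul_row_mx_dilation sqnorm_row_mx mul0mx sqnorm0 addr0.
  rewrite linearZ /= -scalemxAr sqnormZ ler_wpM2l // ltW // exprn_gt0.
have hsum : #|P|%:R * T ^+ p <=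
    (m%:R * (4 * L ^+ 2) / 2 * p%:R) ^+ p * ((d + d)%:R * n%:R ^+ m).
  have := @moment_le _ _ _ m Z (4 * L ^+ 2) Zsym Zsum Zc p.
  rewrite card_ord => /(_ (mulr_ge0 (ler0n _ _) (ltW L2))); apply: le_trans.
  rewrite mulr_natl -sumr_const big_mkcond /=; apply: ler_sum => s _.
  by case: ifP => // /markov.
(* This is [p <= 2 * u] rewritten; each of the [p] factors thus gains [1/4] over [T]. *)
have r_le : m%:R * (4 * L ^+ 2) / 2 * p%:R <= T / 4.
  have : p%:R * (8 * L ^+ 2) <= m%:R * eps ^+ 2.
    rewrite -ler_pdivlMr ?mulr_gt0 //; apply: le_trans pu _; rewrite /u.
    rewrite le_eqVlt; apply/orP; left; apply/eqP; field; exact: lt0r_neq0.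
  rewrite /T => h; have := ler_wpM2l (ltW m0) h; lra.
rewrite -(ler_pM2r (exprn_gt0 p T0)); apply: le_trans hsum _.
have N0 : 0 <= n%:R ^+ m :> R by rewrite exprn_ge0.
have r0 : 0 <= m%:R * (4 * L ^+ 2) / 2 * p%:R :> R by rewrite !mulr_ge0 // ltW.
apply: (@le_trans _ _ ((T / 4) ^+ p * ((d + d)%:R * n%:R ^+ m))).
  apply: ler_wpM2r; first by rewrite mulr_ge0.
  by apply: lerXn2r; rewrite ?nnegrE // divr_ge0 // ltW.
(* The other half of the choice of [p]: [expR u <= expR p <= 4 ^ p]. *)
have : (d + d)%:R <= delta * 4 ^+ p :> R.
  rewrite addnn -mul2n natrM; apply: le_trans dexp _.
  apply: ler_wpM2l; first exact: ltW.
  apply: le_trans (_ : expR p%:R <= _); first by rewrite ler_expR.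
  rewrite -[p%:R]mulr1 expRM_natl.
  by apply: lerXn2r; rewrite ?nnegrE ?expR_ge0 // expR1_le4.
move=> h; have T40 : 0 <= (T / 4) ^+ p by rewrite exprn_ge0 // divr_ge0 // ltW.
have := ler_wpM2r N0 (ler_wpM2l T40 h).
have -> : (T / 4) ^+ p * (delta * 4 ^+ p) = delta * T ^+ p.
  by rewrite mulrCA -exprMn divfK.
by move=> hT; rewrite [leLHS]mulrA [leRHS]mulrAC.
Qed.
End Count.

(** * Spectral norm bounds as quadratic inequalities *)

Section SpectralNorm.
Variables (R : realType).

Lemma sqr_l2norm d (v : 'rV[R]_d) : l2norm v ^+ 2 = sqnorm v.
Proof. by rewrite /l2norm sqr_sqrtr // sqnorm_ge0. Qed.

Lemma l2norm_ge0 d (v : 'rV[R]_d) : 0 <= l2norm v.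
Proof. exact: sqrtr_ge0. Qed.

Lemma l2norm_le_sqr d (v : 'rV[R]_d) c : 0 <= c -> (l2norm v <= c) = (sqnorm v <= c ^+ 2).
Proof. by move=> c0; rewrite -sqr_l2norm ler_sqr ?nnegrE // l2norm_ge0. Qed.

Lemma spectral_norm_leP d e (M : 'M[R]_(d, e)) eps : 0 <= eps ->
  spectral_norm M <= eps <->
  forall v, sqnorm v <= 1 -> sqnorm (v *m M^T) <= eps ^+ 2.
Proof.
move=> e0; split=> [h v v1|h].
  rewrite -l2norm_le_sqr //; apply: le_trans h; apply: ub_le_sup.
    (* The Frobenius norm bounds the set, so its [sup] is a genuine least upper bound. *)
    exists (Num.sqrt (\tr (M^T *m M^T^T))) => _ [w w1 <-].
    rewrite l2norm_le_sqr ?sqrtr_ge0 // sqr_sqrtr ?mxtrace_mulmx_tr_ge0 //.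
    apply: le_trans (sqnorm_mulmx_le _ _) _.
    rewrite -[leRHS]mul1r ler_wpM2r ?mxtrace_mulmx_tr_ge0 //.
    by move: w1; rewrite /= l2norm_le_sqr // expr1n.
  by exists v => //=; rewrite l2norm_le_sqr // expr1n.
apply: ge_sup.
  by exists (l2norm (0 *m M^T)), 0 => //=; rewrite l2norm_le_sqr // sqnorm0 expr1n.
by move=> _ [w w1 <-]; rewrite l2norm_le_sqr // h // -[1](expr1n _ 2) -l2norm_le_sqr.
Qed.

(** The homogeneous form has no unit ball constraint, so it can be tested on rational vectors. *)
Lemma spectral_norm_le_homP d e (M : 'M[R]_(d, e)) eps : 0 <= eps ->
  spectral_norm M <= eps <-> forall v, sqnorm (v *m M^T) <= eps ^+ 2 * sqnorm v.
Proof.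
move=> e0; rewrite spectral_norm_leP //; split=> h v.
  have [->|v0] := eqVneq v 0; first by rewrite mul0mx !sqnorm0 mulr0.
  have n0 : 0 < sqnorm v by rewrite lt0r sqnorm_eq0 v0 sqnorm_ge0.
  have l0 : 0 < l2norm v by rewrite sqrtr_gt0.
  have := h ((l2norm v)^-1 *: v); rewrite -scalemxAl !sqnormZ exprVn sqr_l2norm.
  by rewrite mulVf ?gt_eqF // => /(_ (lexx _)); rewrite mulrC ler_pdivrMr.
by move=> v1; apply: le_trans (h v) _; rewrite -[leRHS]mulr1 ler_wpM2l ?exprn_ge0.
Qed.

Lemma cvg_sumr (I : finType) (T : Type) (F : set_system T) {FF : Filter F}
    (g : I -> T -> R) (l : I -> R) :
  (forall i, g i x @[x --> F] --> l i) ->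
  \sum_i g i x @[x --> F] --> \sum_i l i.
Proof. by move=> gl; apply: cvg_big => //; exact: add_continuous. Qed.

Lemma cvg_sqnorm d (T : Type) (F : set_system T) {FF : Filter F}
    (g : T -> 'rV[R]_d) (l : 'rV[R]_d) :
  g x @[x --> F] --> l -> sqnorm (g x) @[x --> F] --> sqnorm l.
Proof.
move=> gl; rewrite /sqnorm; apply: cvg_sumr => j.
have h : (g x) 0 j @[x --> F] --> l 0 j.
  by apply: (cvg_comp g (fun M : 'rV[R]_d => M 0 j) gl); exact: coord_continuous.
exact: (cvgM h h).
Qed.

Lemma continuous_sqnorm_mulmx d e (M : 'M[R]_(d, e)) :
  continuous (fun v : 'rV[R]_d => sqnorm (v *m M)).
Proof.
move=> v; rewrite /sqnorm; apply: (@cvg_sumr _ _ (nbhs v) (nbhs_filter v)) => j.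
have h : (w *m M) 0 j @[w --> v] --> (v *m M) 0 j.
  have -> : (fun w : 'rV[R]_d => (w *m M) 0 j) = fun w => \sum_k w 0 k * M k j.
    by apply/funext => w; rewrite mxE.
  rewrite mxE.
  apply: (@cvg_sumr _ _ (nbhs v) (nbhs_filter v)) => k; apply: cvgMr_tmp; exact: coord_continuous.
exact: (cvgM h h).
Qed.

Lemma closure_rational_rV d (v : 'rV[R]_d) :
  closure (range (map_mx ratr : 'rV[rat]_d -> 'rV[R]_d)) v.
Proof.
move=> U /nbhs_ballP[e /= e0 eU].
have hq j : exists q : rat, `|v 0 j - ratr q| < e.
  have /rat_in_itvoo[q] : v 0 j < v 0 j + e by rewrite ltrDl.
  rewrite in_itv /= => /andP[h1 h2]; exists q.
  by rewrite distrC ger0_norm ?subr_ge0 ?(ltW h1) // ltrBlDl.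
have [q hqE] := choice hq.
exists (map_mx ratr (\row_j q j)); split; first by exists (\row_j q j).
by apply: eU; split=> // i j; rewrite ord1 !mxE; exact: hqE.
Qed.

(** Both sides are continuous in the vector and rational vectors are dense; a countable family of
    tests thus suffices for measurability. *)
Lemma sqnorm_mulmx_le_rat d e (M : 'M[R]_(d, e)) c :
  (forall q : 'rV[rat]_d, sqnorm (map_mx ratr q *m M) <= c * sqnorm (map_mx ratr q)) ->
  forall v, sqnorm (v *m M) <= c * sqnorm v.
Proof.
move=> hq v; pose g (w : 'rV[R]_d) := c * sqnorm w - sqnorm (w *m M).
have cg : continuous g.
  move=> w; have h := @cvg_sqnorm _ _ (nbhs w) (nbhs_filter w) id w cvg_id.
  exact: (cvgB (cvgM (cvg_cst c) h) (@continuous_sqnorm_mulmx _ _ M w)).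
have /closure_id gE : closed (g @^-1` [set r | 0 <= r]).
  by move/continuous_closedP : cg; apply; exact: closed_ge.
rewrite -subr_ge0 -/(g v); suff : (g @^-1` [set r | 0 <= r]) v by [].
rewrite gE; move: (@closure_rational_rV _ v); apply: closureS => _ [q _ <-] /=.
by rewrite /g subr_ge0.
Qed.

End SpectralNorm.

(** * Hessians as limits of difference quotients *)

Section Derivatives.
Variables (R : realType).

(** Turns directional derivatives, which are limits at a punctured neighbourhood, into limits of
    sequences. *)
Lemma harmonic_cvg_dnbhs0 : @harmonic R @ \oo --> 0^'.
Proof.
move=> U hU.
have h : \forall k \near \oo, harmonic k != 0 -> U (@harmonic R k) := @cvg_harmonic R _ hU.
change (\forall k \near \oo, U (@harmonic R k)).
apply: filterS h => k; apply.
by rewrite gt_eqF // harmonic_gt0.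
Qed.

Lemma cvg_jacobian_quotient p q (g : 'rV[R]_p -> 'rV[R]_q)
    (x v : 'rV[R]_p) : differentiable g x ->
  (k.+1%:R *: (g (k.+1%:R^-1 *: v + x) - g x)) @[k --> \oo] --> v *m jacobian g x.
Proof.
move=> dg; rewrite -deriveEjacobian //.
have := @diff_derivable _ _ _ g x v dg.
move=> /(cvg_comp _ _ harmonic_cvg_dnbhs0).
apply: cvg_trans; apply: near_eq_cvg; near=> k.
by rewrite /= invrK.
Unshelve. all: by end_near. Qed.

(** [v *m hessian f x] is the derivative of the gradient along [v]; the Lipschitz bound on
    difference quotients passes to the limit. *)
Lemma sqnorm_mulmx_hessian_le d L (f : 'rV[R]_d -> R) x v :
  twice_differentiable f -> lipschitz_gradient L f ->
  sqnorm (v *m hessian f x) <= L ^+ 2 * sqnorm v.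
Proof.
move=> [_ df] hL.
have cq := @cvg_sqnorm _ _ _ _ eventually_filter _ _
  (@cvg_jacobian_quotient _ _ (gradient f) x v (df x)).
rewrite -(cvg_lim _ cq) //; apply: limr_le; first by apply/cvg_ex; eexists; exact: cq.
apply: nearW => k; rewrite sqnormZ.
have := hL (k.+1%:R^-1 *: v + x) x; rewrite addrK => h.
have h2 : sqnorm (gradient f (k.+1%:R^-1 *: v + x) - gradient f x) <=
    L ^+ 2 * (k.+1%:R^-1 ^+ 2 * sqnorm v).
  rewrite -sqnormZ -!sqr_l2norm -exprMn lerXn2r ?nnegrE ?l2norm_ge0 //.
  (* [L] carries no sign; [L] times the norm is nonnegative because by [h] it dominates a norm. *)
  exact: le_trans (l2norm_ge0 _) h.
have k0 : 0 < k.+1%:R ^+ 2 :> R by rewrite exprn_gt0.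
apply: le_trans (ler_wpM2l (ltW k0) h2) _.
by rewrite exprVn (mulrCA (L ^+ 2)) mulVKf ?gt_eqF.
Qed.

Lemma gradient_finite_sum d n (f : 'I_n -> 'rV[R]_d -> R) x :
  (forall i, differentiable (f i) x) ->
  gradient (finite_sum_objective f) x = n%:R^-1 *: \sum_i gradient (f i) x.
Proof.
move=> df; apply/rowP => j; rewrite !mxE summxE.
have -> : finite_sum_objective f = n%:R^-1 \*: (\sum_i f i).
  by apply/funext => y; rewrite /finite_sum_objective /= fct_sumE.
rewrite deriveZ; last exact/diff_derivable/differentiable_sum.
rewrite derive_sum; last by move=> i; exact: diff_derivable.
by congr (_ * _); apply: eq_bigr => i _; rewrite mxE.
Qed.

Lemma hessian_finite_sum d n (f : 'I_n -> 'rV[R]_d -> R) x :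
  (forall i, twice_differentiable (f i)) ->
  hessian (finite_sum_objective f) x = n%:R^-1 *: \sum_i hessian (f i) x.
Proof.
move=> df.
have gE : gradient (finite_sum_objective f) = n%:R^-1 \*: (\sum_i gradient (f i)).
  apply/funext => y; rewrite gradient_finite_sum; last by move=> i; case: (df i).
  by rewrite /= fct_sumE.
have dg i : differentiable (gradient (f i)) x by case: (df i).
have ds : differentiable (\sum_i gradient (f i)) x by exact: differentiable_sum.
apply/row_matrixP => i; rewrite !rowE /hessian gE -deriveEjacobian; last exact: differentiableZ.
rewrite deriveZ; last exact: diff_derivable.
rewrite derive_sum; last by move=> k; exact: diff_derivable.
rewrite -scalemxAr mulmx_sumr; congr (_ *: _); apply: eq_bigr => k _.
by rewrite deriveEjacobian.
Qed.

End Derivatives.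

(** * Borel measurability of Hessian entries and norm bounds *)

Section Borel.
Variables (R : realType) (d : nat).

Let rVB := g_sigma_algebraType [set A : set 'rV[R]_d | open A].

Lemma continuous_borel_fun (g : 'rV[R]_d -> R) :
  continuous g -> measurable_fun [set: rVB] g.
Proof.
move=> /continuousP cg; apply: (measurability _ (RGenOpens.measurableE R)).
move=> _ [_ [a [b ->] <-]]; rewrite setTI; apply: sub_gen_smallest.
exact/cg/interval_open.
Qed.

(** Second derivatives may be discontinuous, but they are pointwise limits of difference quotients
    of the gradient, which is continuous because it is differentiable. *)
Lemma hessian_entry_borel (f : 'rV[R]_d -> R) i j : twice_differentiable f ->
  measurable_fun [set: rVB] (fun x : 'rV[R]_d => hessian f x i j).
Proof.
move=> [_ df]; pose e : 'rV[R]_d := delta_mx 0 i.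
have cg : continuous (gradient f) by move=> y; exact/differentiable_continuous/df.
have cgj : continuous (fun y => gradient f y 0 j).
  move=> y; apply: (@continuous_comp _ _ _ (gradient f) (fun M : 'rV[R]_d => M 0 j)).
    exact: cg.
  exact: coord_continuous.
apply: (@measurable_fun_cvg _ rVB _ _
   (fun k x => k.+1%:R * (gradient f (k.+1%:R^-1 *: e + x) 0 j - gradient f x 0 j))).
  move=> k; apply: measurable_funM => //; apply: measurable_funB; last exact: continuous_borel_fun.
  apply: continuous_borel_fun => y.
  apply: (@continuous_comp _ _ _ (fun x : 'rV[R]_d => k.+1%:R^-1 *: e + x)
    (fun y => gradient f y 0 j)); last exact: cgj.
  exact: (cvgD (cvg_cst _) cvg_id).
move=> x _.
have := @cvg_jacobian_quotient _ _ _ (gradient f) x e (df x) => h.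
have := cvg_comp _ _ h (@coord_continuous _ _ _ 0 j _).
rewrite -rowE mxE; apply: cvg_trans; apply: near_eq_cvg; near=> k.
by rewrite /= !mxE.
Unshelve. all: by end_near. Qed.

(** The event is a countable intersection, over rational test vectors, of polynomial inequalities in
    the entries. *)
Lemma spectral_norm_le_borel (M : 'rV[R]_d -> 'M[R]_d) eps : 0 <= eps ->
  (forall i j, measurable_fun [set: rVB] (fun x => M x i j)) ->
  borel_rV [set x | spectral_norm (M x) <= eps].
Proof.
move=> e0 mM.
pose A (q : 'rV[rat]_d) := [set x | sqnorm (map_mx ratr q *m (M x)^T) <=
    eps ^+ 2 * sqnorm (map_mx ratr q : 'rV[R]_d)].
have -> : [set x | spectral_norm (M x) <= eps] = ~` \bigcup_q ~` A q.
  apply/seteqP; split=> [x /= /(spectral_norm_le_homP _ e0) hx [q _]|x /= hx].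
    by apply; exact: hx.
  apply/(spectral_norm_le_homP _ e0); apply: sqnorm_mulmx_le_rat => q.
  by apply: contrapT => hq; apply: hx; exists q.
have mA q : measurable (A q : set rVB).
  rewrite /A -[X in measurable X]setTI; apply: measurable_fun_ler => //.
  rewrite /sqnorm; apply: measurable_sum => j; apply: measurable_funX.
  have -> : (fun x => (map_mx ratr q *m (M x)^T) 0 j) =
      fun x => \sum_k ratr (q 0 k) * M x j k.
    by apply/funext => y; rewrite mxE; apply: eq_bigr => k _; rewrite !mxE.
  by apply: measurable_sum => k; apply: measurable_funM => //; exact: mM.
suff : measurable (~` \bigcup_q ~` A q : set rVB) by [].
apply: measurableC; apply: countable_bigcupT_measurable => // q.
exact: measurableC.
Qed.

End Borel.

(** * From counting samples to probabilities *)

Section Probability.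
Variables (dT : measure_display) (T : measurableType dT) (R : realType).
Variable P : probability T R.

(** The sum is the expectation of the number of [s] with [w \in B s], which is at most [K]
    pointwise. *)
Lemma sum_probability_le (S : finType) (B : S -> set T) (K : R) : 0 <= K ->
  (forall s, measurable (B s)) -> (forall w, #|[pred s | w \in B s]|%:R <= K) ->
  (\sum_s P (B s) <= K%:E)%E.
Proof.
move=> K0 mB hK.
have mf s : measurable_fun setT (fun w => (\1_(B s) w)%:E : \bar R).
  by apply/measurable_EFinP; exact: measurable_indic.
have f0 s w : setT w -> (0 <= (\1_(B s) w)%:E :> \bar R)%E by rewrite lee_fin.
have -> : (\sum_s P (B s) = \int[P]_w (\sum_s (\1_(B s) w)%:E))%E.
  rewrite (ge0_integral_sum P measurableT mf f0).
  by apply: eq_bigr => s _; rewrite integral_indic // setIT.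
apply: (@le_trans _ _ (\int[P]_w (cst K%:E w))%E); last first.
  rewrite integral_cst // -[leRHS]mule1; apply: lee_wpmul2l; first by rewrite lee_fin.
  exact: (probability_le1 P measurableT).
apply: ge0_le_integral => //.
- by move=> w _; apply: sume_ge0 => s _; rewrite lee_fin.
- by apply: emeasurable_sum => s; exact: mf.
move=> w _; rewrite sumEFin lee_fin; apply: le_trans (hK w).
rewrite -sum1_card natr_sum [leRHS]big_mkcond /=; apply: ler_sum => s _.
by rewrite indicE inE; case: (w \in B s).
Qed.

Variables (d n m : nat) (x : T -> 'rV[R]_d) (xi : 'I_m -> T -> 'I_n).
Hypothesis hs : uniform_sampling P x xi.

Let drawn (s : {ffun 'I_m -> 'I_n}) := [set w | [ffun j => xi j w] = s].

Let drawnE s : drawn s = \bigcap_(j in [set` [set: 'I_m]%SET]) (xi j @^-1` [set s j]).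
Proof.
apply/seteqP; split=> [w <- j _|w hw]; first by rewrite /= ffunE.
by apply/ffunP => j; rewrite ffunE; apply: hw; rewrite /= inE.
Qed.

Let draw_measurable1 j i : measurable (xi j @^-1` [set i]).
Proof. by apply: (draw_measurable hs (j := j)); exists [set i] => //; rewrite setTI. Qed.

Let drawn_measurable s : measurable (drawn s).
Proof. by rewrite drawnE; apply: fin_bigcap_measurable. Qed.

Lemma probability_drawn s : P [set w | [ffun j => xi j w] = s] = (n%:R^-1 ^+ m)%:E.
Proof.
rewrite -[X in P X]/(drawn s) drawnE.
have := @draws_independent _ _ _ _ _ _ _ _ _ hs [set: 'I_m]%SET
  (fun j => xi j @^-1` [set s j]).
move=> -> => [|j _]; last by exists [set s j] => //; rewrite setTI.
under eq_bigr do rewrite (draw_uniform hs).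
by rewrite prodEFin prodr_const cardsT card_ord.
Qed.

(** The bad event is split by the value [s] of the sample. Independence gives each piece the weight
    [n ^- m] times the probability that the point is bad for [s], and the count at each fixed point
    bounds the sum of the latter. *)
Lemma sample_event (good : {ffun 'I_m -> 'I_n} -> set 'rV[R]_d) (delta : R) :
  (forall s, borel_rV (good s)) -> 0 <= delta ->
  (forall y, #|[pred s | ~~ (y \in good s)]|%:R <= delta * n%:R ^+ m) ->
  let E := [set w | good [ffun j => xi j w] (x w)] in
  measurable E /\ ((1 - delta)%:E <= P E)%E.
Proof.
move=> bgood d0 hcount E.
have bbad s : borel_rV (~` good s) by apply: sigma_algebraC; exact: bgood.
have mx B : borel_rV B -> measurable (x @^-1` B).
  by move=> bB; apply: (point_measurable hs); exists B => //; rewrite setTI.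
pose bad s := x @^-1` (~` good s).
have mbad s : measurable (bad s) by exact/mx.
have EC : ~` E = \bigcup_s (drawn s `&` bad s).
  apply/seteqP; split=> [w hw|w [s _ [<- hw]]]; last exact: hw.
  by exists [ffun j => xi j w].
have mEC : measurable (~` E).
  rewrite EC; apply: fin_bigcup_measurable; first exact: finite_finset.
  by move=> s _; apply: measurableI.
have mE : measurable E by rewrite -[E]setCK; exact: measurableC.
split=> //.
suff hEC : (P (~` E) <= delta%:E)%E.
  rewrite -[E]setCK probability_setC // EFinB; exact: leeB.
have PE : P (~` E) = (\sum_s P (drawn s `&` bad s))%E.
  rewrite EC measure_fin_bigcup.
  - rewrite (fsbig_seq _ _ (index_enum_uniq _)); apply: eq_fsbigl.
    by apply/seteqP; split=> s //= _; rewrite mem_index_enum.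
  - exact: finite_finset.
  - move=> s s' _ _ [w [[<- _] [<- _]]] //.
  - by move=> s _; apply: measurableI.
have indep s : P (drawn s `&` bad s) = ((n%:R^-1 ^+ m)%:E * P (bad s))%E.
  rewrite -(probability_drawn s); apply: (draws_independent_of_point hs).
    by exists [set s] => //; rewrite setTI.
  by exists (~` good s) => //; rewrite setTI.
rewrite PE; under eq_bigr do rewrite indep.
rewrite -ge0_sume_distrr; last by move=> s _; exact: measure_ge0.
have h : (\sum_s P (bad s) <= (delta * n%:R ^+ m)%:E)%E.
  apply: sum_probability_le => // [|w]; first by rewrite mulr_ge0 ?exprn_ge0.
  apply: le_trans (hcount (x w)); rewrite ler_nat; apply: subset_leq_card.
  apply/fintype.subsetP => s /set_mem hb; apply/negP => /set_mem; exact: hb.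
have n0 : (0 <= (n%:R^-1 ^+ m)%:E :> \bar R)%E by rewrite lee_fin exprn_ge0 ?invr_ge0.
apply: (le_trans (lee_wpmul2l n0 h)); rewrite -EFinM lee_fin.
rewrite mulrCA -exprMn -[leRHS]mulr1; apply: ler_wpM2l => //.
apply: exprn_ile1; first by rewrite mulr_ge0 ?invr_ge0.
(* For [n = 0] the convention [0^-1 = 0] makes the product [0] instead of [1]; both are at most
   [1]. *)
have [->|n1] := eqVneq (n%:R : R) 0; first by rewrite mulr0.
by rewrite mulVf.
Qed.

End Probability.

(** Adds the degenerate cases to [deviation_count]: for [d = 0] or [L = 0] every deviation vanishes
    and no sample is bad. Otherwise [L] is replaced by its absolute value, as only its square
    occurs. *)
Lemma spectral_deviation_count (R : realType) (d n m : nat)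
    (A : 'I_n -> 'M[R]_d) (L eps delta : R) :
  0 < eps -> 0 < delta -> delta < 1 ->
  (forall i v, sqnorm (v *m A i) <= L ^+ 2 * sqnorm v) ->
  16 * L ^+ 2 * ln (2 * d%:R / delta) / eps ^+ 2 <= m%:R ->
  #|[pred s : {ffun 'I_m -> 'I_n} |
     ~~ (spectral_norm (sample_deviation A s) <= eps)]|%:R <= delta * n%:R ^+ m.
Proof.
move=> e0 delta0 delta1 hA hm; set bad := [pred s | _].
have badP s : s \in bad -> exists2 v, sqnorm v <= 1 & eps ^+ 2 <=
    sqnorm (v *m (sample_deviation A s)^T).
  rewrite inE => /negP hs; apply: contrapT => hv; apply: hs.
  apply/(spectral_norm_leP _ (ltW e0)) => v v1; rewrite leNgt; apply/negP => h.
  by apply: hv; exists v => //; exact: ltW.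
have triv : (forall s, s \notin bad) -> #|bad|%:R <= delta * n%:R ^+ m.
  move=> h; rewrite eq_card0 ?mulr_ge0 ?exprn_ge0 // ?ltW // => s.
  exact/negbTE/h.
have e2 : 0 < eps ^+ 2 by rewrite exprn_gt0.
case: (posnP d) => [d0|d0].
  apply: triv => s; apply/negP => /badP[v _]; rewrite leNgt => /negP; apply.
  by rewrite /sqnorm big1 // => j; have := ltn_ord j; rewrite {2}d0.
have [L0|L0] := eqVneq L 0.
  have A0 i : A i = 0.
    apply/row_matrixP => k; rewrite rowE row0; apply/eqP.
    by rewrite -sqnorm_eq0 eq_le sqnorm_ge0 andbT (le_trans (hA _ _)) // L0 expr0n mul0r.
  apply: triv => s; apply/negP => /badP[v _]; rewrite leNgt => /negP; apply.
  rewrite /sample_deviation !big1 // !scaler0 subr0 trmx0 mulmx0 sqnorm0.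
  exact: e2.
apply: (@deviation_count R d n m A `|L| eps delta) => //.
- by rewrite normr_gt0.
- by move=> i v; rewrite real_normK ?num_real.
- by rewrite real_normK ?num_real.
Qed.

Theorem theorem2 (R : realType) (d n : nat) (f : 'I_n -> 'rV[R]_d -> R)
    (L1 delta epsB : R)
    (hf : forall i, twice_differentiable (f i))
    (hL : forall i, lipschitz_gradient L1 (f i))
    (hdelta0 : 0 < delta) (hdelta1 : delta < 1) (hepsB : 0 < epsB)
    (dT : measure_display) (T : measurableType dT) (P : probability T R)
    (x : nat -> T -> 'rV[R]_d)
    (m : nat -> nat) (xi : forall t, 'I_(m t) -> T -> 'I_n)
    (hsampling : forall t, uniform_sampling P (x t) (xi t)) :
  let B := fun (t : nat) (w : T) =>
    subsampled_hessian f (fun j => xi t j w) (x t w) in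
  let H := hessian (finite_sum_objective f) in
  forall t : nat,
    16 * L1 ^+ 2 * ln (2 * d%:R / delta) / epsB ^+ 2 <= (m t)%:R ->
    let E := [set w | spectral_norm (B t w - H (x t w)) <= epsB] in
    measurable E /\ ((1 - delta)%:E <= P E)%E.
Proof.
move=> B H t hm E.
(* Separating the index map [s] from the point [y] lets the count be applied at each fixed [y],
   before the iterate is substituted. *)
pose dev (s : {ffun 'I_(m t) -> 'I_n}) y : 'M[R]_d :=
  sample_deviation (fun i => hessian (f i) y) s.
pose good s := [set y | spectral_norm (dev s y) <= epsB].
have devE w : B t w - H (x t w) = dev [ffun j => xi t j w] (x t w).
  rewrite /dev (@sample_deviationE _ _ _ _ _ _ (fun j => xi t j w)).
    by rewrite /B /H /subsampled_hessian (hessian_finite_sum _ hf).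
  by move=> j; rewrite ffunE.
have -> : E = [set w | good [ffun j => xi t j w] (x t w)].
  by apply/funext => w; rewrite /E /good /mkset devE.
apply: (sample_event (hsampling t)); last first.
- move=> y; apply: le_trans (@spectral_deviation_count _ _ _ (m t)
    (fun i => hessian (f i) y) L1 epsB delta _ _ _ _ hm) => //.
    rewrite ler_nat; apply: subset_leq_card; apply/fintype.subsetP => s.
    by rewrite !inE => h; apply: contra h => h; apply/mem_set.
  by move=> i v; apply: sqnorm_mulmx_hessian_le.
- exact: ltW.
move=> s; apply: spectral_norm_le_borel; first exact: ltW.
move=> i j; pose h k (y : 'rV[R]_d) := hessian (f k) y i j.
have mh k := hessian_entry_borel i j (hf k).
have -> : (fun y => dev s y i j) = fun y =>
    (m t)%:R^-1 * (\sum_j h (s j) y) - n%:R^-1 * \sum_k h k y.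
  by apply/funext => y; rewrite /dev /sample_deviation !mxE !summxE.
by apply: measurable_funB; apply: measurable_funM => //; apply: measurable_sum => k; exact: mh.
Qed.
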